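(* (In $\mathbf{ZF}$.) Let $\mathbf{X}$ be a locally compact Hausdorff $\mathcal{K}$-Loeb space which has a cuf base. Then every $G_\delta$-subspace of $\mathbf{X}$ is Loeb.
   Context: The result is a theorem of $\mathbf{ZF}$ (Zermelo–Fraenkel set theory without the axiom of choice). A set is countable if it is equipotent with a subset of $\omega$. A set is a cuf set if it is expressible as a countable union of finite sets. A topological space has a cuf base if it has an open base which is a cuf set. A topological space is Loeb if the family of all its non-empty closed subsets has a choice function, and $\mathcal{K}$-Loeb if the family of all its non-empty compact subsets has a choice function. A $G_\delta$-subspace is a subspace whose underlying set is a countable intersection of open sets of the space. *)

(* Defs.v *)
Set Implicit Arguments.
Unset Strict Implicit.
Unset Printing Implicit Defensive.

(* A theorem of ZF is stated as a theorem about every model of the first-order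
   theory ZF: all spaces, functions, countings and choice functions below are
   elements of the model.  The schemas of separation and replacement range over
   first-order formulas with parameters only.  If they ranged over arbitrary
   predicates of type [V -> Prop], a choice principle of the metatheory would
   make every model satisfy the axiom of choice. *)

Record set_structure := SetStructure {
  universe :> Type;
  mem : universe -> universe -> Prop
}.

Declare Scope zf_scope.
Open Scope zf_scope.
Notation "x ∈ y" := (mem x y) (at level 70, no associativity) : zf_scope.

(* Formulas of the language {∈, =}, with de Bruijn indices for variables. *)
Inductive formula : Type :=
| f_mem (i j : nat)
| f_eq (i j : nat)
| f_false
| f_imp (p q : formula)
| f_and (p q : formula)
| f_or (p q : formula)
| f_all (p : formula)
| f_ex (p : formula).

Definition scons {T : Type} (x : T) (e : nat -> T) (n : nat) : T :=
  match n with O => x | S m => e m end.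

Fixpoint sat {V : set_structure} (e : nat -> V) (phi : formula) : Prop :=
  match phi with
  | f_mem i j => e i ∈ e j
  | f_eq i j => e i = e j
  | f_false => False
  | f_imp p q => sat e p -> sat e q
  | f_and p q => sat e p /\ sat e q
  | f_or p q => sat e p \/ sat e q
  | f_all p => forall x : V, sat (scons x e) p
  | f_ex p => exists x : V, sat (scons x e) p
  end.

Definition subset {V : set_structure} (x y : V) : Prop :=
  forall z : V, z ∈ x -> z ∈ y.
Notation "x ⊆ y" := (subset x y) (at level 70, no associativity) : zf_scope.

Definition nonempty {V : set_structure} (x : V) : Prop := exists z : V, z ∈ x.

Definition is_empty {V : set_structure} (x : V) : Prop := forall z : V, ~ z ∈ x.

Definition is_pair {V : set_structure} (p a b : V) : Prop :=
  forall z : V, z ∈ p <-> z = a \/ z = b.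

Definition is_union {V : set_structure} (u A : V) : Prop :=
  forall z : V, z ∈ u <-> exists a : V, a ∈ A /\ z ∈ a.

Definition is_inter {V : set_structure} (w a b : V) : Prop :=
  forall z : V, z ∈ w <-> z ∈ a /\ z ∈ b.

Definition is_diff {V : set_structure} (w a b : V) : Prop :=
  forall z : V, z ∈ w <-> z ∈ a /\ ~ z ∈ b.

Definition is_succ {V : set_structure} (s x : V) : Prop :=
  forall z : V, z ∈ s <-> z ∈ x \/ z = x.

Definition inductive {V : set_structure} (w : V) : Prop :=
  (exists e : V, is_empty e /\ e ∈ w) /\
  (forall x : V, x ∈ w -> exists s : V, is_succ s x /\ s ∈ w).

Record ZF (V : set_structure) : Prop := {
  zf_extensionality :
    forall x y : V, (forall z : V, z ∈ x <-> z ∈ y) -> x = y;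
  zf_foundation :
    forall x : V, nonempty x -> exists y : V, y ∈ x /\ forall z : V, z ∈ x -> ~ z ∈ y;
  zf_pairing : forall a b : V, exists p : V, is_pair p a b;
  zf_union : forall A : V, exists u : V, is_union u A;
  zf_powerset : forall x : V, exists P : V, forall y : V, y ∈ P <-> y ⊆ x;
  zf_infinity : exists w : V, inductive w;
  zf_separation :
    forall (phi : formula) (e : nat -> V) (A : V),
      exists B : V, forall x : V, x ∈ B <-> x ∈ A /\ sat (scons x e) phi;
  zf_replacement :
    forall (phi : formula) (e : nat -> V) (A : V),
      (forall x y y' : V, x ∈ A ->
         sat (scons x (scons y e)) phi -> sat (scons x (scons y' e)) phi -> y = y') ->
      exists B : V, forall y : V,
        y ∈ B <-> exists x : V, x ∈ A /\ sat (scons x (scons y e)) phi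
}.

(* Kuratowski pairs {{a}, {a, b}}. *)
Definition is_opair {V : set_structure} (p a b : V) : Prop :=
  exists u v : V, is_pair u a a /\ is_pair v a b /\ is_pair p u v.

Definition maps {V : set_structure} (f a b : V) : Prop :=
  exists p : V, is_opair p a b /\ p ∈ f.

Definition function_on {V : set_structure} (f A : V) : Prop :=
  (forall p : V, p ∈ f -> exists a b : V, a ∈ A /\ is_opair p a b) /\
  (forall a : V, a ∈ A -> exists! b : V, maps f a b).

Definition bijection {V : set_structure} (f A B : V) : Prop :=
  function_on f A /\
  (forall a b : V, maps f a b -> b ∈ B) /\
  (forall b : V, b ∈ B -> exists! a : V, maps f a b).

Definition equipotent {V : set_structure} (A B : V) : Prop :=
  exists f : V, bijection f A B.

(* This is the ω of the model, which need not be the standard [nat]. *)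
Definition is_omega {V : set_structure} (w : V) : Prop :=
  inductive w /\ forall v : V, inductive v -> w ⊆ v.

Definition finite {V : set_structure} (A : V) : Prop :=
  exists w n : V, is_omega w /\ n ∈ w /\ equipotent A n.

Definition countable {V : set_structure} (A : V) : Prop :=
  exists w s : V, is_omega w /\ s ⊆ w /\ equipotent A s.

Definition cuf {V : set_structure} (A : V) : Prop :=
  exists F : V, countable F /\ (forall a : V, a ∈ F -> finite a) /\ is_union A F.

Definition choice_function {V : set_structure} (f F : V) : Prop :=
  function_on f F /\ forall a b : V, maps f a b -> b ∈ a.

(* In the sequel, a space is given by its underlying set X and the set T of its
   open sets. *)
Definition topology {V : set_structure} (X T : V) : Prop :=
  (forall U : V, U ∈ T -> U ⊆ X) /\
  (exists e : V, is_empty e /\ e ∈ T) /\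
  X ∈ T /\
  (forall U U' W : V, U ∈ T -> U' ∈ T -> is_inter W U U' -> W ∈ T) /\
  (forall A U : V, A ⊆ T -> is_union U A -> U ∈ T).

Definition closed {V : set_structure} (X T C : V) : Prop :=
  C ⊆ X /\ exists U : V, U ∈ T /\ is_diff U X C.

Definition hausdorff {V : set_structure} (X T : V) : Prop :=
  forall x y : V, x ∈ X -> y ∈ X -> x <> y ->
    exists U W : V, U ∈ T /\ W ∈ T /\ x ∈ U /\ y ∈ W /\
      forall z : V, ~ (z ∈ U /\ z ∈ W).

Definition covers {V : set_structure} (A K : V) : Prop :=
  forall x : V, x ∈ K -> exists U : V, U ∈ A /\ x ∈ U.

Definition compact {V : set_structure} (X T K : V) : Prop :=
  K ⊆ X /\
  forall A : V, A ⊆ T -> covers A K ->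
    exists F : V, F ⊆ A /\ finite F /\ covers F K.

Definition neighborhood {V : set_structure} (X T x N : V) : Prop :=
  N ⊆ X /\ exists U : V, U ∈ T /\ x ∈ U /\ U ⊆ N.

Definition locally_compact {V : set_structure} (X T : V) : Prop :=
  forall x : V, x ∈ X -> exists K : V, compact X T K /\ neighborhood X T x K.

Definition base {V : set_structure} (T B : V) : Prop :=
  B ⊆ T /\ forall U : V, U ∈ T -> exists A : V, A ⊆ B /\ is_union U A.

Definition has_cuf_base {V : set_structure} (T : V) : Prop :=
  exists B : V, base T B /\ cuf B.

Definition Loeb {V : set_structure} (X T : V) : Prop :=
  exists F : V, (forall C : V, C ∈ F <-> closed X T C /\ nonempty C) /\
    exists f : V, choice_function f F.

Definition K_Loeb {V : set_structure} (X T : V) : Prop :=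
  exists F : V, (forall K : V, K ∈ F <-> compact X T K /\ nonempty K) /\
    exists f : V, choice_function f F.

(* The intersection is taken inside X, so the empty family yields X itself. *)
Definition G_delta {V : set_structure} (X T Y : V) : Prop :=
  exists G : V, countable G /\ G ⊆ T /\
    forall x : V, x ∈ Y <-> x ∈ X /\ forall U : V, U ∈ G -> x ∈ U.

Definition subspace_topology {V : set_structure} (T Y S : V) : Prop :=
  forall W : V, W ∈ S <-> exists U : V, U ∈ T /\ is_inter W U Y.

(* Main.v *)
Require Import Defs.
From Stdlib Require Import Classical ClassicalEpsilon PeanoNat.

(** Let B be a cuf base of X, and let Y be the intersection of X with open sets
    O(n), where n runs over a subset of ω; put O(n) = X for the other n.  The choice function for compact sets
    yields one for the closed subsets of Y as soon as every non-empty relatively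
    closed C ⊆ Y is assigned, by an explicit definition, a non-empty compact set
    contained in C.

    A cuf set B admits multiple choice: from a non-empty Φ ⊆ B a finite non-empty
    subset of Φ can be selected, namely the intersection of Φ with the first finite
    piece of B that meets it ([cuf_multiple_choice]).  Given C, put W(0) = X.  Given
    an open W(n) that meets C, consider the family of those U in B that meet C and
    have a compact hull inside W(n) ∩ O(n); it is non-empty because X is locally
    compact Hausdorff and C ⊆ O(n).  Let W(n+1) be the union of the selected finite
    subfamily.  Then W(n+1) is open, meets C, and lies in a compact set contained in
    W(n) ∩ O(n) ([shrink_hull], [shrink_exists]).

    The core of C is the set of the points all of whose open neighbourhoods meet
    every W(n) ∩ C.  It is closed and lies in every compact set that contains some
    W(n), so it is compact and contained in every O(n), hence in Y; being contained
    in the closure of C, it is a subset of C.  It is non-empty by compactness: if it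
    were empty, a compact set containing W(1) would be covered by finitely many open
    sets, each missing some W(n) ∩ C; as the W(n) decrease, one W(n) ∩ C would be
    empty ([core_nonempty]).

    All of this takes place in a model in which only definable classes can be
    separated, so each construction is accompanied by a proof that it is definable
    from parameters.  The ω of the model may be non-standard; the sequence W is
    therefore built by the recursion theorem of the model ([iterate]), and facts
    about finite sets are proved by the model's own induction ([finite_ind]). *)

(** * First-order definability with parameters *)

Fixpoint rename (r : nat -> nat) (phi : formula) : formula :=
  match phi with
  | f_mem i j => f_mem (r i) (r j)
  | f_eq i j => f_eq (r i) (r j)
  | f_false => f_false
  | f_imp p q => f_imp (rename r p) (rename r q)
  | f_and p q => f_and (rename r p) (rename r q)
  | f_or p q => f_or (rename r p) (rename r q)
  | f_all p => f_all (rename (scons 0 (fun n => S (r n))) p)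
  | f_ex p => f_ex (rename (scons 0 (fun n => S (r n))) p)
  end.

Lemma sat_rename {V : set_structure} (phi : formula) (r : nat -> nat) (e e' : nat -> V) :
  (forall n, e' (r n) = e n) -> (sat e phi <-> sat e' (rename r phi)).
Proof.
  assert (lift : forall r e e' x, (forall n, e' (r n) = e n) ->
    forall n, scons (x : V) e' (scons 0 (fun n => S (r n)) n) = scons x e n).
  { intros r0 e0 e0' x H [|n]; simpl; auto. }
  revert r e e'; induction phi; simpl; intros r e e' H.
  - rewrite !H; tauto.
  - rewrite !H; tauto.
  - tauto.
  - rewrite (IHphi1 r e e' H), (IHphi2 r e e' H); tauto.
  - rewrite (IHphi1 r e e' H), (IHphi2 r e e' H); tauto.
  - rewrite (IHphi1 r e e' H), (IHphi2 r e e' H); tauto.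
  - split; intros H1 x; specialize (H1 x);
      apply (IHphi _ _ _ (lift r e e' x H)); exact H1.
  - split; intros [x H1]; exists x;
      apply (IHphi _ _ _ (lift r e e' x H)); exact H1.
Qed.

(** The sequence a(0), b(0), a(1), b(1), and so on. *)
Definition interleave {A : Type} (a b : nat -> A) (n : nat) : A :=
  if Nat.even n then a (Nat.div2 n) else b (Nat.div2 n).

Lemma interleave_left {A : Type} (a b : nat -> A) n : interleave a b (2 * n) = a n.
Proof.
  unfold interleave. rewrite Nat.even_even, Nat.div2_double. reflexivity.
Qed.

Lemma interleave_right {A : Type} (a b : nat -> A) n : interleave a b (S (2 * n)) = b n.
Proof.
  unfold interleave. rewrite Nat.even_succ, Nat.odd_even, Nat.div2_succ_double. reflexivity.
Qed.

(** Renaming the even variables by f and the odd ones by g turns a formula about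
    two interleaved environments into one about a single environment. *)
Lemma sat_interleave {V : set_structure} phi (f g : nat -> nat) (e c e' : nat -> V) :
  (forall n, e' (f n) = e n) -> (forall n, e' (g n) = c n) ->
  (sat (interleave e c) phi <-> sat e' (rename (interleave f g) phi)).
Proof.
  intros Hf Hg. apply sat_rename. intro n. unfold interleave.
  destruct (Nat.even n); auto.
Qed.

(** A predicate of environments is definable if it is given by a formula whose
    even variables are read in the environment and whose odd variables are
    parameters from the model. *)
Definition definable {V : set_structure} (P : (nat -> V) -> Prop) : Prop :=
  exists (phi : formula) (c : nat -> V), forall e, sat (interleave e c) phi <-> P e.

(** A function of the environment is definable if its graph is, the value being
    put in front of the environment. *)
Definition definable_fun {V : set_structure} (t : (nat -> V) -> V) : Prop :=
  definable (fun e => e 0 = t (fun n => e (S n))).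

(* A model of ZF is non-empty, which supplies the parameters of formulas that
   need none and the default value of descriptions. *)
Lemma zf_inhabited {V : set_structure} : ZF V -> inhabited V.
Proof. intros H. destruct (zf_infinity H) as [w _]. exact (inhabits w). Qed.

Section InModel.
Context {V : set_structure} (HZF : ZF V).
Implicit Types (P Q : (nat -> V) -> Prop) (e : nat -> V) (t : (nat -> V) -> V).

Lemma definable_ext P Q : (forall e, P e <-> Q e) -> definable P -> definable Q.
Proof.
  intros H (phi & c & Hp). exists phi, c. intro e. rewrite Hp. apply H.
Qed.

Lemma definable_rename P (r : nat -> nat) :
  definable P -> definable (fun e => P (fun n => e (r n))).
Proof.
  intros (phi & c & Hp).
  exists (rename (interleave (fun n => 2 * r n) (fun n => S (2 * n))) phi), c.
  intro e. rewrite <- (Hp (fun n => e (r n))). symmetry.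
  apply sat_interleave; intro n; [apply interleave_left | apply interleave_right].
Qed.

Lemma definable_binary (op : Prop -> Prop -> Prop) (fop : formula -> formula -> formula) P Q :
  (forall (A A' B B' : Prop), (A <-> A') -> (B <-> B') -> (op A B <-> op A' B')) ->
  (forall (e : nat -> V) p q, sat e (fop p q) <-> op (sat e p) (sat e q)) ->
  definable P -> definable Q -> definable (fun e => op (P e) (Q e)).
Proof.
  intros Hop Hfop (p & c & Hp) (q & d & Hq).
  exists (fop (rename (interleave (fun n => 2 * n) (fun n => S (2 * (2 * n)))) p)
              (rename (interleave (fun n => 2 * n) (fun n => S (2 * S (2 * n)))) q)),
    (interleave c d).
  intro e. rewrite Hfop. apply Hop.
  - rewrite <- Hp. symmetry. apply sat_interleave; intro n.
    + apply interleave_left.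
    + rewrite interleave_right. apply interleave_left.
  - rewrite <- Hq. symmetry. apply sat_interleave; intro n.
    + apply interleave_left.
    + rewrite interleave_right. apply interleave_right.
Qed.

Lemma definable_and P Q : definable P -> definable Q -> definable (fun e => P e /\ Q e).
Proof. apply (definable_binary and f_and); [tauto | simpl; tauto]. Qed.

Lemma definable_or P Q : definable P -> definable Q -> definable (fun e => P e \/ Q e).
Proof. apply (definable_binary or f_or); [tauto | simpl; tauto]. Qed.

Lemma definable_imp P Q : definable P -> definable Q -> definable (fun e => P e -> Q e).
Proof. apply (definable_binary (fun A B => A -> B) f_imp); [tauto | simpl; tauto]. Qed.

Lemma definable_iff P Q : definable P -> definable Q -> definable (fun e => P e <-> Q e).
Proof. intros; apply definable_and; apply definable_imp; assumption. Qed.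

Lemma definable_false : definable (fun _ : nat -> V => False).
Proof.
  destruct (zf_inhabited HZF) as [x].
  exists f_false, (fun _ => x). simpl; tauto.
Qed.

Lemma definable_not P : definable P -> definable (fun e => ~ P e).
Proof. intro H. apply definable_imp; [exact H | apply definable_false]. Qed.

(** The first variable of a definable predicate can be bound: the value put in
    front of the environment may be put in front of the parameters as well. *)
Lemma definable_quantifier (P : V -> (nat -> V) -> Prop) :
  definable (fun e => P (e 0) (fun n => e (S n))) ->
  exists phi c, forall e x, sat (scons x (interleave e c)) phi <-> P x e.
Proof.
  intros (phi & c & Hp).
  exists (rename (interleave (scons 0 (fun n => S (2 * n))) (fun n => S (S (2 * n)))) phi), c.
  intros e x. transitivity (sat (interleave (scons x e) c) phi); [symmetry | apply Hp].
  apply sat_interleave.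
  - intros [|n]; [reflexivity | exact (interleave_left _ _ n)].
  - intro n. exact (interleave_right _ _ n).
Qed.

Lemma definable_all (P : V -> (nat -> V) -> Prop) :
  definable (fun e => P (e 0) (fun n => e (S n))) -> definable (fun e => forall x, P x e).
Proof.
  intros H. destruct (definable_quantifier P H) as (phi & c & Hp).
  exists (f_all phi), c. intro e. simpl.
  split; intros H1 x; specialize (H1 x); apply Hp; exact H1.
Qed.

Lemma definable_ex (P : V -> (nat -> V) -> Prop) :
  definable (fun e => P (e 0) (fun n => e (S n))) -> definable (fun e => exists x, P x e).
Proof.
  intros H. destruct (definable_quantifier P H) as (phi & c & Hp).
  exists (f_ex phi), c. intro e. simpl.
  split; intros [x H1]; exists x; apply Hp; exact H1.
Qed.

(** Variables of the environment can be frozen into parameters. *)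
Lemma definable_section (P : V -> (nat -> V) -> Prop) (e0 : nat -> V) :
  definable (fun e => P (e 0) (fun n => e (S n))) -> definable (fun e => P (e 0) e0).
Proof.
  intros (phi & c & Hp).
  exists (rename (interleave (scons 0 (fun n => S (2 * (2 * n)))) (fun n => S (2 * S (2 * n)))) phi),
    (interleave e0 c).
  intro e. rewrite <- (Hp (scons (e 0) e0)). symmetry. apply sat_interleave.
  - intros [|n]; [exact (interleave_left e (interleave e0 c) 0)|].
    cbn [scons]. rewrite interleave_right. apply interleave_left.
  - intro n. rewrite interleave_right. apply interleave_right.
Qed.

Lemma definable_var (k : nat) : definable_fun (fun e => e k).
Proof.
  destruct (zf_inhabited HZF) as [x].
  exists (f_eq (2 * 0) (2 * S k)), (fun _ => x).
  intro e. cbn [sat]. rewrite !interleave_left. tauto.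
Qed.

Lemma definable_const (a : V) : definable_fun (fun _ => a).
Proof.
  exists (f_eq (2 * 0) (S (2 * 0))), (fun _ => a).
  intro e. cbn [sat]. rewrite interleave_left, interleave_right. tauto.
Qed.

(** Substitution of a definable function for the first variable. *)
Lemma definable_app (P : V -> (nat -> V) -> Prop) t :
  definable_fun t -> definable (fun e => P (e 0) (fun n => e (S n))) ->
  definable (fun e => P (t e) e).
Proof.
  intros Ht HP.
  apply definable_ext with (fun e => exists x, x = t e /\ P x e).
  { intro e. split; [intros (x & -> & H); exact H | intro H; exists (t e); auto]. }
  apply definable_ex, definable_and; assumption.
Qed.

(** Weakening by unused bound variables. *)
Lemma definable_fun_shift t : definable_fun t -> definable_fun (fun e => t (fun n => e (S n))).
Proof. intro H. exact (definable_rename _ (scons 0 (fun n => S (S n))) H). Qed.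

Lemma definable_eq t t' :
  definable_fun t -> definable_fun t' -> definable (fun e => t e = t' e).
Proof.
  intros H H'. apply (definable_app (fun x e => x = t' e)); assumption.
Qed.

Lemma definable_mem t t' :
  definable_fun t -> definable_fun t' -> definable (fun e => t e ∈ t' e).
Proof.
  intros H H'. apply (definable_app (fun x e => x ∈ t' e)); [assumption|].
  apply (definable_app (fun y e => e 0 ∈ y)); [apply definable_fun_shift, H'|].
  destruct (zf_inhabited HZF) as [x].
  exists (f_mem (2 * 1) (2 * 0)), (fun _ => x).
  intro e. cbn [sat]. rewrite !interleave_left. tauto.
Qed.

(** A set is definable from the environment when it is the only one with a
    definable property. *)
Lemma definable_fun_spec (P : V -> (nat -> V) -> Prop) t :
  (forall x e, x = t e <-> P x e) -> definable (fun e => P (e 0) (fun n => e (S n))) ->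
  definable_fun t.
Proof.
  intros H. apply definable_ext. intro e. symmetry. apply H.
Qed.

(** Weakening of a predicate under one more bound variable. *)
Lemma definable_weaken (P : V -> (nat -> V) -> Prop) :
  definable (fun e => P (e 0) (fun n => e (S n))) ->
  definable (fun e => P (e 0) (fun n => e (S (S n)))).
Proof. intro H. exact (definable_rename _ (scons 0 (fun n => S (S n))) H). Qed.

Lemma definable_fun_shift2 t :
  definable_fun t -> definable_fun (fun e => t (fun n => e (S (S n)))).
Proof. intro H. exact (definable_fun_shift _ (definable_fun_shift t H)). Qed.

Lemma definable_fun_shift3 t :
  definable_fun t -> definable_fun (fun e => t (fun n => e (S (S (S n))))).
Proof. intro H. exact (definable_fun_shift _ (definable_fun_shift2 t H)). Qed.

(** Definability, with parameters, of predicates with one, two and three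
    arguments. *)
Definition class_definable (P : V -> Prop) : Prop :=
  definable (fun e => P (e 0)).
Definition relation_definable (P : V -> V -> Prop) : Prop :=
  definable (fun e => P (e 0) (e 1)).
Definition relation3_definable (P : V -> V -> V -> Prop) : Prop :=
  definable (fun e => P (e 0) (e 1) (e 2)).

Lemma definable_class (P : V -> Prop) t :
  class_definable P -> definable_fun t -> definable (fun e => P (t e)).
Proof.
  intros HP Ht. apply (definable_app (fun x _ => P x)); assumption.
Qed.

Lemma definable_relation (P : V -> V -> Prop) t1 t2 :
  relation_definable P -> definable_fun t1 -> definable_fun t2 ->
  definable (fun e => P (t1 e) (t2 e)).
Proof.
  intros HP H1 H2.
  apply (definable_app (fun x e => P x (t2 e))); [assumption|].
  apply (definable_app (fun y e => P (e 0) y)); [apply definable_fun_shift; assumption|].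
  exact (definable_rename _ (fun n => match n with 0 => 1 | _ => 0 end) HP).
Qed.

Lemma definable_relation3 (P : V -> V -> V -> Prop) t1 t2 t3 :
  relation3_definable P -> definable_fun t1 -> definable_fun t2 -> definable_fun t3 ->
  definable (fun e => P (t1 e) (t2 e) (t3 e)).
Proof.
  intros HP H1 H2 H3.
  apply (definable_app (fun x e => P x (t2 e) (t3 e))); [assumption|].
  apply (definable_app (fun y e => P (e 0) y (t3 (fun n => e (S n)))));
    [apply definable_fun_shift; assumption|].
  apply (definable_app (fun z e => P (e 1) (e 0) z));
    [apply definable_fun_shift2; assumption|].
  exact (definable_rename _ (fun n => match n with 0 => 2 | 1 => 1 | _ => 0 end) HP).
Qed.

(* From here on only the closure properties above are used, and unification
   must not unfold definability down to formulas. *)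
Opaque definable definable_fun.

(* The rules for sets are added once the set operations are available. *)
Ltac definability_set := fail.

Ltac definability_step :=
  first
  [ assumption
  | simple apply definable_and | simple apply definable_or | simple apply definable_iff
  | simple apply definable_false | simple apply definable_not
  | simple apply definable_imp | simple apply definable_all | simple apply definable_ex
  | simple apply definable_const | simple apply definable_var
  | simple apply definable_eq | simple apply definable_mem
  | match goal with
    | H : class_definable ?P |- _ => simple apply (definable_class P)
    | H : relation_definable ?P |- _ => simple apply (definable_relation P)
    | H : relation3_definable ?P |- _ => simple apply (definable_relation3 P)
    end
  | definability_set
  | progress unfold class_definable, relation_definable, relation3_definable ].

(* Proves definability by following the syntax of the predicate. *)
Ltac definability := cbv beta; repeat (definability_step; cbv beta).

(** * Set operations of the model *)

(** Some set with the property P, arbitrary if there is none.  It is definable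
    only where P determines it; see [definable_fun_spec]. *)
Definition the_set (P : V -> Prop) : V := epsilon (zf_inhabited HZF) P.

Lemma the_setP (P : V -> Prop) : (exists x, P x) -> P (the_set P).
Proof. apply epsilon_spec. Qed.

Lemma set_ext (x y : V) : (forall z, z ∈ x <-> z ∈ y) -> x = y.
Proof. apply (zf_extensionality HZF). Qed.

(** The elements of A satisfying P; meaningful when P is definable. *)
Definition sep (A : V) (P : V -> Prop) : V :=
  the_set (fun B => forall x, x ∈ B <-> x ∈ A /\ P x).
Definition upair (a b : V) : V := the_set (fun p => is_pair p a b).
Definition union (A : V) : V := the_set (fun u => is_union u A).
Definition power (A : V) : V := the_set (fun u => forall y, y ∈ u <-> y ⊆ A).
(** The Kuratowski pair. *)
Definition opair (a b : V) : V := upair (upair a a) (upair a b).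
Definition empty : V := the_set is_empty.
Definition cup (A B : V) : V := union (upair A B).
(** A together with the element x. *)
Definition adjoin (A x : V) : V := cup A (upair x x).
Definition inter (A B : V) : V := sep A (fun x => x ∈ B).
Definition diff (A B : V) : V := sep A (fun x => ~ x ∈ B).
(** Cartesian product: Kuratowski pairs with components in A and B are sets of
    subsets of the union of A and B. *)
Definition prod (A B : V) : V :=
  sep (power (power (union (upair A B)))) (fun p => exists a b, a ∈ A /\ b ∈ B /\ p = opair a b).

Lemma in_sep A (P : V -> Prop) x : class_definable P -> (x ∈ sep A P <-> x ∈ A /\ P x).
Proof.
  intros H. revert x.
  apply (the_setP (fun B => forall x, x ∈ B <-> x ∈ A /\ P x)).
  destruct (definable_quantifier (fun x _ => P x) H) as (phi & c & Hp).
  (* P ignores the environment, so its even positions are filled arbitrarily. *)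
  destruct (zf_separation HZF phi (interleave c c) A) as [B HB].
  exists B. intro x. rewrite HB, Hp. tauto.
Qed.

Lemma in_upair a b x : x ∈ upair a b <-> x = a \/ x = b.
Proof. revert x. apply (the_setP _ (zf_pairing HZF a b)). Qed.

Lemma in_union A x : x ∈ union A <-> exists a, a ∈ A /\ x ∈ a.
Proof. revert x. apply (the_setP _ (zf_union HZF A)). Qed.

Lemma in_power A x : x ∈ power A <-> x ⊆ A.
Proof. revert x. apply (the_setP _ (zf_powerset HZF A)). Qed.

Lemma in_cup A B x : x ∈ cup A B <-> x ∈ A \/ x ∈ B.
Proof.
  unfold cup. rewrite in_union. split.
  - intros (C & H & Hx). apply in_upair in H as [->| ->]; auto.
  - intros [H | H]; [exists A | exists B]; rewrite in_upair; auto.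
Qed.

Lemma in_adjoin A a x : x ∈ adjoin A a <-> x ∈ A \/ x = a.
Proof. unfold adjoin. rewrite in_cup, in_upair. tauto. Qed.

Lemma in_empty x : ~ x ∈ empty.
Proof.
  revert x. apply (the_setP is_empty).
  destruct (zf_inhabited HZF) as [a]. exists (sep a (fun _ => False)).
  intros x H. apply in_sep in H; [tauto | exact definable_false].
Qed.

Lemma opair_inj a b c d : opair a b = opair c d -> a = c /\ b = d.
Proof.
  unfold opair. intro H.
  assert (Hm : forall z, (z = upair a a \/ z = upair a b) <-> (z = upair c c \/ z = upair c d)).
  { intro z. rewrite <- !in_upair, H. tauto. }
  assert (Hac : c = a).
  { assert (Hc : c ∈ upair a a).
    { destruct (proj1 (Hm (upair a a)) (or_introl eq_refl)) as [-> | ->]; apply in_upair; auto. }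
    apply in_upair in Hc; tauto. }
  subst c. split; [reflexivity|].
  assert (Hd : d ∈ upair a b).
  { destruct (proj2 (Hm (upair a d)) (or_intror eq_refl)) as [E | E];
      assert (Hd : d ∈ upair a d) by (apply in_upair; auto);
      rewrite E in Hd; apply in_upair in Hd; apply in_upair; tauto. }
  assert (Hb : b ∈ upair a d).
  { destruct (proj1 (Hm (upair a b)) (or_intror eq_refl)) as [E | E];
      assert (Hb : b ∈ upair a b) by (apply in_upair; auto);
      rewrite E in Hb; apply in_upair in Hb; apply in_upair; tauto. }
  apply in_upair in Hd, Hb. intuition congruence.
Qed.

(** ** Definability of the set operations *)

Lemma definable_sep t (P : V -> (nat -> V) -> Prop) :
  definable_fun t -> definable (fun e => P (e 0) (fun n => e (S n))) ->
  definable_fun (fun e => sep (t e) (fun x => P x e)).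
Proof.
  intros Ht HP.
  pose proof (definable_fun_shift2 t Ht). pose proof (definable_weaken P HP).
  apply (definable_fun_spec (fun x e => forall z, z ∈ x <-> z ∈ t e /\ P z e)).
  - intros x e. pose proof (definable_section P e HP) as Hd. split.
    + intros -> z. apply in_sep, Hd.
    + intros H1. apply set_ext. intro z. rewrite H1, in_sep; [tauto | exact Hd].
  - definability.
Qed.

Lemma definable_upair t t' :
  definable_fun t -> definable_fun t' -> definable_fun (fun e => upair (t e) (t' e)).
Proof.
  intros Ht Ht'.
  pose proof (definable_fun_shift2 t Ht). pose proof (definable_fun_shift2 t' Ht').
  apply (definable_fun_spec (fun x e => forall z, z ∈ x <-> z = t e \/ z = t' e)).
  - intros x e. split.
    + intros -> z. apply in_upair.
    + intros H1. apply set_ext. intro z. rewrite H1, in_upair. tauto.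
  - definability.
Qed.

Lemma definable_union t : definable_fun t -> definable_fun (fun e => union (t e)).
Proof.
  intros Ht. pose proof (definable_fun_shift3 t Ht).
  apply (definable_fun_spec (fun x e => forall z, z ∈ x <-> exists a, a ∈ t e /\ z ∈ a)).
  - intros x e. split.
    + intros -> z. apply in_union.
    + intros H1. apply set_ext. intro z. rewrite H1, in_union. tauto.
  - definability.
Qed.

Lemma definable_power t : definable_fun t -> definable_fun (fun e => power (t e)).
Proof.
  intros Ht. pose proof (definable_fun_shift3 t Ht).
  apply (definable_fun_spec (fun x e => forall z, z ∈ x <-> forall a, a ∈ z -> a ∈ t e)).
  - intros x e. split.
    + intros -> z. apply in_power.
    + intros H1. apply set_ext. intro z. rewrite H1, in_power. unfold subset. tauto.
  - definability.
Qed.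

Lemma is_empty_eq x : is_empty x <-> x = empty.
Proof.
  split.
  - intro H. apply set_ext. intro z. split; intro Hz; [destruct (H z Hz) | destruct (in_empty z Hz)].
  - intros ->. exact in_empty.
Qed.

Lemma is_succ_eq s x : is_succ s x <-> s = adjoin x x.
Proof.
  split.
  - intro H. apply set_ext. intro z. rewrite in_adjoin. apply H.
  - intros -> z. apply in_adjoin.
Qed.

Lemma is_union_eq u A : is_union u A <-> u = union A.
Proof.
  split.
  - intro H. apply set_ext. intro z. rewrite in_union. apply H.
  - intros -> z. apply in_union.
Qed.

Lemma is_opair_eq p a b : is_opair p a b <-> p = opair a b.
Proof.
  assert (Hp : forall p a b, is_pair p a b <-> p = upair a b).
  { intros q c d. split.
    - intro H. apply set_ext. intro z. rewrite in_upair. apply H.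
    - intros -> z. apply in_upair. }
  unfold is_opair. split.
  - intros (u & v & Hu & Hv & H). apply Hp in Hu, Hv, H. subst. reflexivity.
  - intros ->. exists (upair a a), (upair a b). rewrite !Hp. auto.
Qed.

Lemma maps_eq f a b : maps f a b <-> opair a b ∈ f.
Proof.
  unfold maps. split.
  - intros (p & H & Hf). apply is_opair_eq in H as ->. exact Hf.
  - intro H. exists (opair a b). rewrite is_opair_eq. auto.
Qed.

Lemma definable_maps t t' t'' :
  definable_fun t -> definable_fun t' -> definable_fun t'' ->
  definable (fun e => maps (t e) (t' e) (t'' e)).
Proof.
  intros. apply definable_ext with (fun e => opair (t' e) (t'' e) ∈ t e).
  - intro e. symmetry. apply maps_eq.
  - apply definable_mem; [|assumption]. repeat apply definable_upair; assumption.
Qed.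

Ltac definability_set ::=
  first
  [ simple apply definable_sep | simple apply definable_upair
  | simple apply definable_union | simple apply definable_power
  | simple apply definable_maps
  | progress unfold opair, adjoin, cup, inter, diff, prod
  | progress unfold unique, subset, nonempty, is_empty, is_pair, is_union, is_diff, is_succ,
      inductive, is_opair, function_on, bijection, equipotent, is_omega, finite, covers,
      compact, closed ].

Lemma in_inter A B x : x ∈ inter A B <-> x ∈ A /\ x ∈ B.
Proof. refine (in_sep A _ x _). definability. Qed.

Lemma in_diff A B x : x ∈ diff A B <-> x ∈ A /\ ~ x ∈ B.
Proof. refine (in_sep A _ x _). definability. Qed.

Lemma in_prod A B a b : opair a b ∈ prod A B <-> a ∈ A /\ b ∈ B.
Proof.
  unfold prod. rewrite in_sep; [|definability]. split.
  - intros (_ & a' & b' & Ha & Hb & E). apply opair_inj in E as [-> ->]. auto.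
  - intros [Ha Hb]. split; [|eauto].
    apply in_power. intros u Hu. apply in_power. intros z Hz. apply in_union.
    apply in_upair in Hu as [-> | ->]; apply in_upair in Hz as [-> | ->];
      [exists A | exists A | exists A | exists B]; rewrite in_upair; auto.
Qed.

(** * Natural numbers of the model *)

Local Notation succ n := (adjoin n n).

Definition omega : V := the_set is_omega.

Lemma omega_spec : is_omega omega.
Proof.
  apply (the_setP is_omega).
  destruct (zf_infinity HZF) as [w Hw].
  assert (Hd : class_definable (fun n => forall v, inductive v -> n ∈ v)) by definability.
  exists (sep w (fun n => forall v, inductive v -> n ∈ v)). split.
  - split.
    + destruct Hw as [(x & Hx & Hxw) _]. apply is_empty_eq in Hx as ->.
      exists empty. split; [exact in_empty|]. apply in_sep; [exact Hd|]. split; [exact Hxw|].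
      intros v [(x & Hx & Hxv) _]. apply is_empty_eq in Hx as ->. exact Hxv.
    + intros x Hx. apply in_sep in Hx as [Hx H]; [|exact Hd].
      exists (succ x). split; [apply is_succ_eq; reflexivity|].
      assert (Hs : forall v, inductive v -> x ∈ v -> succ x ∈ v).
      { intros v Hv Hxv. destruct (proj2 Hv x Hxv) as (s & Hs & Hsv).
        apply is_succ_eq in Hs as ->. exact Hsv. }
      apply in_sep; [exact Hd|]. split; auto.
  - intros v Hv n Hn. apply in_sep in Hn as [_ H]; [auto | exact Hd].
Qed.

Lemma is_omega_eq w : is_omega w -> w = omega.
Proof.
  intros [Hw Hm]. destruct omega_spec as [Ho Hmo].
  apply set_ext. intro n. split; [apply Hm, Ho | apply Hmo, Hw].
Qed.

Lemma zero_in_omega : empty ∈ omega.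
Proof.
  destruct omega_spec as [[(x & Hx & Hxw) _] _]. apply is_empty_eq in Hx as ->. exact Hxw.
Qed.

Lemma succ_in_omega n : n ∈ omega -> succ n ∈ omega.
Proof.
  intro Hn. destruct omega_spec as [[_ H] _]. destruct (H n Hn) as (s & Hs & Hsw).
  apply is_succ_eq in Hs as ->. exact Hsw.
Qed.

Lemma omega_ind (P : V -> Prop) : class_definable P ->
  P empty -> (forall n, n ∈ omega -> P n -> P (succ n)) -> forall n, n ∈ omega -> P n.
Proof.
  intros Hd H0 HS n Hn.
  assert (Hi : inductive (sep omega P)).
  { split.
    - exists empty. split; [exact in_empty|]. apply in_sep; [exact Hd|].
      split; [exact zero_in_omega | exact H0].
    - intros x Hx. apply in_sep in Hx as [Hx HP]; [|exact Hd].
      exists (succ x). split; [apply is_succ_eq; reflexivity|].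
      apply in_sep; [exact Hd|]. split; [apply succ_in_omega; exact Hx | auto]. }
  apply (proj2 omega_spec) in Hi. apply Hi, in_sep in Hn; [tauto | exact Hd].
Qed.

Lemma mem_irrefl (x : V) : ~ x ∈ x.
Proof.
  intro H. destruct (zf_foundation HZF (x := upair x x)) as (y & Hy & Hmin).
  - exists x. apply in_upair; auto.
  - apply in_upair in Hy. apply (Hmin x); [apply in_upair; auto|].
    destruct Hy; subst; exact H.
Qed.

Lemma omega_transitive n : n ∈ omega -> forall m, m ∈ n -> m ⊆ n.
Proof.
  revert n. apply (omega_ind (fun n => forall m, m ∈ n -> m ⊆ n)); [definability | |].
  - intros m Hm. destruct (in_empty m Hm).
  - intros n Hn IH m Hm k Hk. apply in_adjoin. left.
    apply in_adjoin in Hm as [Hm | ->]; [exact (IH m Hm k Hk) | exact Hk].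
Qed.

Lemma zero_le n : n ∈ omega -> empty = n \/ empty ∈ n.
Proof.
  revert n. apply (omega_ind (fun n => empty = n \/ empty ∈ n)); [definability | auto |].
  intros n Hn [<- | H]; right; apply in_adjoin; auto.
Qed.

Lemma succ_le n : n ∈ omega -> forall m, m ∈ n -> succ m = n \/ succ m ∈ n.
Proof.
  revert n. apply (omega_ind (fun n => forall m, m ∈ n -> succ m = n \/ succ m ∈ n)); [definability | |].
  - intros m Hm. destruct (in_empty m Hm).
  - intros n Hn IH m Hm. apply in_adjoin in Hm as [Hm | ->]; [|auto].
    right. apply in_adjoin. destruct (IH m Hm); auto.
Qed.

Lemma omega_trichotomy m n : m ∈ omega -> n ∈ omega -> m ∈ n \/ m = n \/ n ∈ m.
Proof.
  intros Hm Hn. revert m Hm. apply (omega_ind (fun m => m ∈ n \/ m = n \/ n ∈ m)); [definability | |].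
  - destruct (zero_le n Hn); auto.
  - intros m Hm [H | [-> | H]].
    + destruct (succ_le n Hn m H); auto.
    + right; right. apply in_adjoin; auto.
    + right; right. apply in_adjoin; auto.
Qed.

(** * Finite sets *)

(** A symmetric description of bijections, with one condition for both
    functionality and injectivity. *)
Lemma bijection_iff f A B : bijection f A B <->
  (forall p, p ∈ f -> exists a b, a ∈ A /\ b ∈ B /\ p = opair a b) /\
  (forall a, a ∈ A -> exists b, maps f a b) /\
  (forall b, b ∈ B -> exists a, maps f a b) /\
  (forall a a' b b', maps f a b -> maps f a' b' -> (a = a' <-> b = b')).
Proof.
  split.
  - intros [[H1 H2] [H3 H4]].
    assert (H5 : forall a b, maps f a b -> a ∈ A /\ b ∈ B).
    { intros a b H. split; [|exact (H3 a b H)].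
      apply maps_eq in H. destruct (H1 _ H) as (a' & b' & Ha & E).
      apply is_opair_eq, opair_inj in E as [-> ->]. exact Ha. }
    split; [|split; [|split]].
    + intros p Hp. destruct (H1 p Hp) as (a & b & Ha & E). apply is_opair_eq in E as ->.
      exists a, b. split; [exact Ha|]. split; [|reflexivity].
      apply (H3 a b), maps_eq, Hp.
    + intros a Ha. destruct (H2 a Ha) as (b & Hb & _). eauto.
    + intros b Hb. destruct (H4 b Hb) as (a & Ha & _). eauto.
    + intros a a' b b' H H'. destruct (H5 a b H) as [Ha Hb]. split.
      * intros <-. destruct (H2 a Ha) as (c & _ & Hc). rewrite <- (Hc b H). auto.
      * intros <-. destruct (H4 b Hb) as (c & _ & Hc). rewrite <- (Hc a H). auto.
  - intros (H1 & H2 & H3 & H4). split; [split | split].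
    + intros p Hp. destruct (H1 p Hp) as (a & b & Ha & _ & E).
      exists a, b. rewrite is_opair_eq. auto.
    + intros a Ha. destruct (H2 a Ha) as [b Hb]. exists b. split; [exact Hb|].
      intros b' Hb'. apply (H4 a a b b'); auto.
    + intros a b H. apply maps_eq in H. destruct (H1 _ H) as (a' & b' & _ & Hb & E).
      apply opair_inj in E as [-> ->]. exact Hb.
    + intros b Hb. destruct (H3 b Hb) as [a Ha]. exists a. split; [exact Ha|].
      intros a' Ha'. apply (H4 a a' b b); auto.
Qed.

Lemma finite_iff A : finite A <-> exists n, n ∈ omega /\ equipotent A n.
Proof.
  split.
  - intros (w & n & Hw & Hn & H). apply is_omega_eq in Hw as ->. eauto.
  - intros (n & Hn & H). exists omega, n. auto using omega_spec.
Qed.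

Lemma finite_empty : finite empty.
Proof.
  apply finite_iff. exists empty. split; [exact zero_in_omega|].
  exists empty. apply bijection_iff.
  assert (Hm : forall a b, ~ maps empty a b) by (intros a b H; apply maps_eq in H; exact (in_empty _ H)).
  split; [|split; [|split]].
  1-3: intros x Hx; destruct (in_empty x Hx).
  intros a a' b b' H. destruct (Hm _ _ H).
Qed.

Lemma finite_adjoin A x : finite A -> finite (adjoin A x).
Proof.
  intro HA. destruct (classic (x ∈ A)) as [Hx | Hx].
  { replace (adjoin A x) with A; [exact HA|].
    apply set_ext. intro z. rewrite in_adjoin. split; [auto | intros [H | ->]; auto]. }
  apply finite_iff in HA as (n & Hn & f & Hf). apply finite_iff.
  exists (succ n). split; [apply succ_in_omega, Hn|].
  exists (adjoin f (opair x n)).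
  apply bijection_iff in Hf as (H1 & H2 & H3 & H4).
  assert (Hin : forall a b, maps f a b -> a ∈ A /\ b ∈ n).
  { intros a b H. apply maps_eq in H. destruct (H1 _ H) as (a' & b' & Ha & Hb & E).
    apply opair_inj in E as [-> ->]. auto. }
  assert (Hm : forall a b, maps (adjoin f (opair x n)) a b <-> maps f a b \/ (a = x /\ b = n)).
  { intros a b. rewrite !maps_eq, in_adjoin. split.
    - intros [H | H]; [auto | apply opair_inj in H; auto].
    - intros [H | [-> ->]]; auto. }
  apply bijection_iff. split; [|split; [|split]].
  - intros p Hp. apply in_adjoin in Hp as [Hp | ->].
    + destruct (H1 p Hp) as (a & b & Ha & Hb & E).
      exists a, b. rewrite !in_adjoin. auto.
    + exists x, n. rewrite !in_adjoin. auto.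
  - intros a Ha. apply in_adjoin in Ha as [Ha | ->].
    + destruct (H2 a Ha) as [b Hb]. exists b. apply Hm. auto.
    + exists n. apply Hm. auto.
  - intros b Hb. apply in_adjoin in Hb as [Hb | ->].
    + destruct (H3 b Hb) as [a Ha]. exists a. apply Hm. auto.
    + exists x. apply Hm. auto.
  - intros a a' b b' H H'. apply Hm in H, H'.
    destruct H as [H | [-> ->]], H' as [H' | [-> ->]].
    + eapply H4; eassumption.
    + destruct (Hin _ _ H) as [Ha Hb]. split; intros ->; [tauto | destruct (mem_irrefl n Hb)].
    + destruct (Hin _ _ H') as [Ha Hb]. split; intros <-; [tauto | destruct (mem_irrefl n Hb)].
    + tauto.
Qed.

(** Induction on finite sets.  The property must be definable, since the number
    of elements is a natural number of the model. *)
Lemma finite_ind (P : V -> Prop) : class_definable P ->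
  P empty -> (forall A x, P A -> P (adjoin A x)) -> forall A, finite A -> P A.
Proof.
  intros Hd H0 HS A HA. apply finite_iff in HA as (n & Hn & HA).
  revert n Hn A HA. apply (omega_ind (fun n => forall A, equipotent A n -> P A)).
  - definability.
  - intros A [f Hf]. apply bijection_iff in Hf as (H1 & H2 & _).
    replace A with empty; [exact H0|]. symmetry. apply is_empty_eq.
    intros a Ha. destruct (H2 a Ha) as [b Hb]. apply maps_eq in Hb.
    destruct (H1 _ Hb) as (_ & c & _ & Hc & _). exact (in_empty c Hc).
  - intros n Hn IH A [f Hf].
    assert (Hf' := Hf).
    apply bijection_iff in Hf as (H1 & H2 & H3 & H4).
    assert (Hin : forall a b, maps f a b -> a ∈ A /\ b ∈ succ n).
    { intros a b H. apply maps_eq in H. destruct (H1 _ H) as (a' & b' & Ha & Hb & E).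
      apply opair_inj in E as [-> ->]. auto. }
    destruct (H3 n) as [x Hx]; [apply in_adjoin; auto|].
    assert (Hs : forall a, a ∈ diff A (upair x x) <-> a ∈ A /\ a <> x).
    { intro a. rewrite in_diff, in_upair. tauto. }
    replace A with (adjoin (diff A (upair x x)) x).
    2:{ apply set_ext. intro a. rewrite in_adjoin, Hs.
        destruct (classic (a = x)) as [-> | Ha]; [|tauto]. destruct (Hin x n Hx). tauto. }
    apply HS, IH.
    exists (diff f (upair (opair x n) (opair x n))).
    assert (Hm : forall a b, maps (diff f (upair (opair x n) (opair x n))) a b <->
                             maps f a b /\ a <> x /\ b <> n).
    { intros a b. rewrite !maps_eq, in_diff, in_upair. split.
      - intros [H Hne]. split; [exact H|]. rewrite <- maps_eq in H.
        pose proof (H4 _ _ _ _ H Hx) as Hax.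
        split; intro E; apply Hne; apply Hax in E as E'; subst; auto.
      - intros (H & Ha & _). split; [exact H|]. intros [E | E]; apply opair_inj in E; tauto. }
    apply bijection_iff. split; [|split; [|split]].
    + intros p Hp. pose proof Hp as Hp'. apply in_diff in Hp as [Hp _].
      destruct (H1 p Hp) as (a & b & Ha & Hb & ->).
      rewrite <- maps_eq in Hp'. apply Hm in Hp' as (_ & Hax & Hbn).
      exists a, b. rewrite Hs. apply in_adjoin in Hb as [Hb | ->]; tauto.
    + intros a Ha. apply Hs in Ha as [Ha Hax]. destruct (H2 a Ha) as [b Hb].
      exists b. apply Hm. split; [exact Hb|]. split; [exact Hax|].
      intros ->. apply Hax, (H4 _ _ _ _ Hb Hx). reflexivity.
    + intros b Hb. destruct (H3 b) as [a Ha]; [apply in_adjoin; auto|].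
      assert (Hbn : b <> n) by (intros ->; exact (mem_irrefl n Hb)).
      exists a. apply Hm. split; [exact Ha|]. split; [|exact Hbn].
      intros ->. apply Hbn, (H4 _ _ _ _ Ha Hx). reflexivity.
    + intros a a' b b' H H'. apply Hm in H as [H _], H' as [H' _]. eapply H4; eassumption.
Qed.

Lemma finite_subset (A B : V) : finite A -> B ⊆ A -> finite B.
Proof.
  intro HA. revert B. revert A HA.
  apply (finite_ind (fun A => forall B, B ⊆ A -> finite B)); [definability | |].
  - intros B HB. replace B with empty; [exact finite_empty|].
    symmetry. apply is_empty_eq. intros z Hz. exact (in_empty z (HB z Hz)).
  - intros A x IH B HB.
    assert (Hd : finite (diff B (upair x x))).
    { apply IH. intros z Hz. apply in_diff in Hz as [Hz Hne]. rewrite in_upair in Hne.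
      apply HB, in_adjoin in Hz. tauto. }
    destruct (classic (x ∈ B)) as [Hx | Hx].
    + replace B with (adjoin (diff B (upair x x)) x); [apply finite_adjoin, Hd|].
      apply set_ext. intro z. rewrite in_adjoin, in_diff, in_upair.
      destruct (classic (z = x)) as [-> | Hz]; tauto.
    + apply IH. intros z Hz. specialize (HB z Hz). apply in_adjoin in HB as [H | ->]; tauto.
Qed.

Lemma finite_cup (A B : V) : finite A -> finite B -> finite (cup A B).
Proof.
  intros HA HB. revert B HB. apply (finite_ind (fun B => finite (cup A B))); [definability | |].
  - replace (cup A empty) with A; [exact HA|].
    apply set_ext. intro z. rewrite in_cup. split; [auto | intros [H | H]; [exact H | destruct (in_empty z H)]].
  - intros B x H. replace (cup A (adjoin B x)) with (adjoin (cup A B) x); [apply finite_adjoin, H|].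
    apply set_ext. intro z. rewrite in_adjoin, !in_cup, in_adjoin. tauto.
Qed.

(** * Locally compact Hausdorff spaces *)

Section Space.
Context (X T : V) (Htop : topology X T).

Lemma open_subset U : U ∈ T -> U ⊆ X.
Proof. apply Htop. Qed.

Lemma open_whole : X ∈ T.
Proof. apply Htop. Qed.

Lemma open_inter U W : U ∈ T -> W ∈ T -> inter U W ∈ T.
Proof.
  intros HU HW. destruct Htop as (_ & _ & _ & H & _).
  apply (H U W); auto. intro z. apply in_inter.
Qed.

Lemma open_union A : A ⊆ T -> union A ∈ T.
Proof.
  intros HA. destruct Htop as (_ & _ & _ & _ & H).
  apply (H A); auto. apply is_union_eq. reflexivity.
Qed.

Lemma open_local A : (forall x, x ∈ A -> exists U, U ∈ T /\ x ∈ U /\ U ⊆ A) -> A ∈ T.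
Proof.
  intros H.
  assert (Hd : class_definable (fun U => U ⊆ A)) by definability.
  replace A with (union (sep T (fun U => U ⊆ A))).
  - apply open_union. intros U HU. apply in_sep in HU; [tauto | exact Hd].
  - apply set_ext. intro x. rewrite in_union. split.
    + intros (U & HU & Hx). apply in_sep in HU as [_ HU]; auto.
    + intros Hx. destruct (H x Hx) as (U & HU & HxU & HUA).
      exists U. rewrite in_sep; auto.
Qed.

Lemma compact_empty : compact X T empty.
Proof.
  split; [intros x Hx; destruct (in_empty x Hx)|].
  intros A _ _. exists empty. split; [|split; [exact finite_empty|]];
    intros x Hx; destruct (in_empty x Hx).
Qed.

Lemma compact_diff K U : compact X T K -> U ∈ T -> compact X T (diff K U).
Proof.
  intros [HK Hc] HU. split; [intros x Hx; apply in_diff in Hx; apply HK, Hx|].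
  intros A HA Hcov. destruct (Hc (adjoin A U)) as (F & HF & Hfin & HFK).
  - intros W HW. apply in_adjoin in HW as [HW | ->]; auto.
  - intros x Hx. destruct (classic (x ∈ U)) as [HxU | HxU].
    + exists U. rewrite in_adjoin. auto.
    + destruct (Hcov x) as (W & HW & HxW); [apply in_diff; auto|].
      exists W. rewrite in_adjoin. auto.
  - exists (inter F A). split; [intros W HW; apply in_inter in HW; tauto|]. split.
    + apply (finite_subset F); [exact Hfin|]. intros W HW. apply in_inter in HW; tauto.
    + intros x Hx. apply in_diff in Hx as [Hx HxU]. destruct (HFK x Hx) as (W & HW & HxW).
      exists W. split; [|exact HxW]. apply in_inter. split; [exact HW|].
      apply HF, in_adjoin in HW as [HW | ->]; tauto.
Qed.

Lemma compact_cup K L : compact X T K -> compact X T L -> compact X T (cup K L).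
Proof.
  intros [HK Hc] [HL Hd]. split; [intros x Hx; apply in_cup in Hx as [Hx | Hx]; auto|].
  intros A HA Hcov.
  destruct (Hc A HA) as (F & HF & HFf & HFK); [intros x Hx; apply Hcov, in_cup; auto|].
  destruct (Hd A HA) as (G & HG & HGf & HGL); [intros x Hx; apply Hcov, in_cup; auto|].
  exists (cup F G). split; [|split; [apply finite_cup; assumption|]].
  - intros U HU. apply in_cup in HU as [HU | HU]; auto.
  - intros x Hx. apply in_cup in Hx as [Hx | Hx].
    + destruct (HFK x Hx) as (U & HU & HxU). exists U. rewrite in_cup. auto.
    + destruct (HGL x Hx) as (U & HU & HxU). exists U. rewrite in_cup. auto.
Qed.

(** Finitely many sets with compact hulls inside O have a common compact hull
    inside O. *)
Lemma finite_compact_hull Phi O : finite Phi ->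
  (forall U, U ∈ Phi -> exists K, compact X T K /\ U ⊆ K /\ K ⊆ O) ->
  exists K, compact X T K /\ union Phi ⊆ K /\ K ⊆ O.
Proof.
  intro Hfin. revert Phi Hfin.
  apply (finite_ind (fun Phi => (forall U, U ∈ Phi -> exists K, compact X T K /\ U ⊆ K /\ K ⊆ O) ->
    exists K, compact X T K /\ union Phi ⊆ K /\ K ⊆ O)); [definability | |].
  - intros _. exists empty. split; [exact compact_empty|]. split.
    + intros x Hx. apply in_union in Hx as (U & HU & _). destruct (in_empty U HU).
    + intros x Hx. destruct (in_empty x Hx).
  - intros Phi U IH H.
    destruct IH as (K & HK & HPK & HKO); [intros W HW; apply H, in_adjoin; auto|].
    destruct (H U) as (L & HL & HUL & HLO); [apply in_adjoin; auto|].
    exists (cup K L). split; [apply compact_cup; assumption|]. split.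
    + intros x Hx. apply in_union in Hx as (W & HW & Hx). apply in_cup.
      apply in_adjoin in HW as [HW | ->]; [left; apply HPK, in_union; eauto | auto].
    + intros x Hx. apply in_cup in Hx as [Hx | Hx]; auto.
Qed.

Context (Hhaus : hausdorff X T).

(** In a Hausdorff space a compact set and a point outside it have disjoint open
    neighbourhoods. *)
Lemma separate_compact_point K x : compact X T K -> x ∈ X -> ~ x ∈ K ->
  exists U W, U ∈ T /\ W ∈ T /\ x ∈ U /\ K ⊆ W /\ forall z, ~ (z ∈ U /\ z ∈ W).
Proof.
  intros [HK Hc] Hx HxK.
  (* Cover K by the open sets that are disjoint from some neighbourhood of x, and
     intersect the neighbourhoods belonging to a finite subcover. *)
  set (P := fun W => exists U, U ∈ T /\ x ∈ U /\ forall z, ~ (z ∈ U /\ z ∈ W)).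
  assert (Hd : class_definable P) by (unfold P; definability).
  destruct (Hc (sep T P)) as (F & HF & Hfin & HFK).
  - intros W HW. apply in_sep in HW; tauto.
  - intros y Hy. destruct (Hhaus x y) as (U & W & HU & HW & HxU & HyW & H); auto.
    { intros ->. exact (HxK Hy). }
    exists W. split; [|exact HyW]. apply in_sep; [exact Hd|]. split; [exact HW|].
    exists U. auto.
  - enough (HU : exists U, U ∈ T /\ x ∈ U /\ forall W, W ∈ F -> forall z, ~ (z ∈ U /\ z ∈ W)).
    { destruct HU as (U & HU & HxU & H). exists U, (union F).
      split; [exact HU|]. split; [|split; [exact HxU | split]].
      - apply open_union. intros W HW. apply HF, in_sep in HW; tauto.
      - intros y Hy. apply in_union. destruct (HFK y Hy) as (W & HW & HyW). eauto.
      - intros z [HzU Hz]. apply in_union in Hz as (W & HW & Hz). exact (H W HW z (conj HzU Hz)). }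
    assert (HP : forall W, W ∈ F -> P W).
    { intros W HW. apply HF, in_sep in HW; tauto. }
    clear HF HFK. revert F Hfin HP.
    apply (finite_ind (fun F => (forall W, W ∈ F -> P W) -> exists U, U ∈ T /\ x ∈ U /\
      forall W, W ∈ F -> forall z, ~ (z ∈ U /\ z ∈ W))); [definability | |].
    + intros _. exists X. split; [exact open_whole|]. split; [exact Hx|].
      intros W HW. destruct (in_empty W HW).
    + intros F W IH H.
      destruct IH as (U & HU & HxU & HUF); [intros W' HW'; apply H, in_adjoin; auto|].
      destruct (H W) as (U' & HU' & HxU' & HUW); [apply in_adjoin; auto|].
      exists (inter U U'). split; [apply open_inter; assumption|].
      split; [apply in_inter; auto|].
      intros W' HW' z [Hz HzW]. apply in_inter in Hz as [Hz Hz'].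
      apply in_adjoin in HW' as [HW' | ->]; [apply (HUF W' HW' z) | apply (HUW z)]; auto.
Qed.

Lemma compact_closed K : compact X T K -> diff X K ∈ T.
Proof.
  intro HK. apply open_local. intros x Hx. apply in_diff in Hx as [Hx HxK].
  destruct (separate_compact_point K x HK Hx HxK) as (U & W & HU & _ & HxU & HKW & H).
  exists U. split; [exact HU|]. split; [exact HxU|].
  intros z Hz. apply in_diff. split; [exact (open_subset U HU z Hz)|].
  intro HzK. apply (H z). auto.
Qed.

Context (Hlc : locally_compact X T).

(** In a locally compact Hausdorff space the compact neighbourhoods of a point are
    a neighbourhood base. *)
Lemma compact_neighborhood_inside O x : O ∈ T -> x ∈ O ->
  exists U K, U ∈ T /\ x ∈ U /\ U ⊆ K /\ compact X T K /\ K ⊆ O.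
Proof.
  intros HO Hx. pose proof (open_subset O HO x Hx) as HxX.
  destruct (Hlc x HxX) as (K & HK & _ & U & HU & HxU & HUK).
  (* K may stick out of O; remove from it a neighbourhood of the part outside O. *)
  destruct (separate_compact_point (diff K O) x) as (U' & W & HU' & HW & HxU' & HKW & H).
  - apply compact_diff; assumption.
  - exact HxX.
  - rewrite in_diff. tauto.
  - exists (inter U U'), (diff K W). split; [apply open_inter; assumption|].
    split; [apply in_inter; auto|]. split; [|split; [apply compact_diff; assumption|]].
    + intros z Hz. apply in_inter in Hz as [Hz Hz']. apply in_diff. split; [auto|].
      intro HzW. apply (H z); auto.
    + intros z Hz. apply in_diff in Hz as [Hz HzW].
      apply NNPP. intro HzO. apply HzW, HKW, in_diff. auto.
Qed.

Lemma base_compact_inside B O x : base T B -> O ∈ T -> x ∈ O ->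
  exists U K, U ∈ B /\ x ∈ U /\ U ⊆ K /\ compact X T K /\ K ⊆ O.
Proof.
  intros [_ HB] HO Hx.
  destruct (compact_neighborhood_inside O x HO Hx) as (U & K & HU & HxU & HUK & HK & HKO).
  destruct (HB U HU) as (A & HA & HUA). apply HUA in HxU as (W & HW & HxW).
  exists W, K. split; [auto|]. split; [exact HxW|]. split; [|auto].
  intros z Hz. apply HUK, HUA. eauto.
Qed.

End Space.

(** * Recursion along the natural numbers *)

(** The graph of the sequence that starts at [a] and whose term number n+1 is
    obtained from the term number n by the relation [Step n]: the pair of n and W
    belongs to every set of pairs that contains the initial pair and is closed
    under [Step].  Such sets exist when the values stay in a fixed set, called [D]
    below; without one the definition would be vacuous. *)
Definition iterate (a : V) (Step : V -> V -> V -> Prop) (n W : V) : Prop :=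
  forall r, opair empty a ∈ r ->
    (forall m U U', opair m U ∈ r -> Step m U U' -> opair (succ m) U' ∈ r) ->
    opair n W ∈ r.

Lemma succ_not_empty (n : V) : succ n <> empty.
Proof. intro E. apply (in_empty n). rewrite <- E. apply in_adjoin; auto. Qed.

Lemma succ_inj (m n : V) : m ∈ omega -> succ m = succ n -> m = n.
Proof.
  intros Hm E.
  assert (H1 : m ∈ succ n) by (rewrite <- E; apply in_adjoin; auto).
  assert (H2 : n ∈ succ m) by (rewrite E; apply in_adjoin; auto).
  apply in_adjoin in H1 as [H1 | H1]; [|exact H1].
  apply in_adjoin in H2 as [H2 | H2]; [|auto].
  destruct (mem_irrefl m (omega_transitive m Hm n H2 m H1)).
Qed.

Section Recursion.
Context (D a : V) (Step : V -> V -> V -> Prop).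
Context (HStep : relation3_definable Step) (Ha : a ∈ D)
  (HD : forall n W W', W ∈ D -> Step n W W' -> W' ∈ D).

Lemma iterate_zero : iterate a Step empty a.
Proof. intros r H0 _. exact H0. Qed.

Lemma iterate_succ n W W' : iterate a Step n W -> Step n W W' -> iterate a Step (succ n) W'.
Proof. intros H HS r H0 Hr. apply (Hr n W); [apply H; assumption | exact HS]. Qed.

Lemma iterate_ind (Q : V -> V -> Prop) : relation_definable Q ->
  Q empty a ->
  (forall n W W', n ∈ omega -> W ∈ D -> iterate a Step n W -> Q n W -> Step n W W' ->
     Q (succ n) W') ->
  forall n W, iterate a Step n W -> n ∈ omega /\ W ∈ D /\ Q n W.
Proof.
  intros HQ Q0 QS n W H.
  set (P := fun p => exists n W, p = opair n W /\ iterate a Step n W /\ Q n W).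
  assert (Hd : class_definable P) by (unfold P, iterate; definability).
  assert (Hin : forall n W, opair n W ∈ sep (prod omega D) P <->
    (n ∈ omega /\ W ∈ D) /\ iterate a Step n W /\ Q n W).
  { intros m U. rewrite in_sep, in_prod; [|exact Hd].
    split; intros [H1 H2]; (split; [exact H1|]).
    - destruct H2 as (m' & U' & E & H2). apply opair_inj in E as [-> ->]. exact H2.
    - exists m, U. auto. }
  assert (Hr : opair n W ∈ sep (prod omega D) P).
  { apply H.
    - apply Hin. auto using zero_in_omega, iterate_zero.
    - intros m U U' Hm HU. apply Hin in Hm as ((Hm & HUD) & Hi & Hq). apply Hin.
      split; [split; [apply succ_in_omega, Hm | apply (HD m U U'); assumption]|].
      split; [apply (iterate_succ m U); assumption | apply (QS m U); assumption]. }
  apply Hin in Hr. tauto.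
Qed.

(** Every pair of the least closed set is the initial one or comes from a step. *)
Lemma iterate_inv n W : iterate a Step n W ->
  (n = empty /\ W = a) \/ exists m U, iterate a Step m U /\ n = succ m /\ Step m U W.
Proof.
  intro H.
  apply (iterate_ind (fun n W => (n = empty /\ W = a) \/
    exists m U, iterate a Step m U /\ n = succ m /\ Step m U W)) in H; [tauto | | |].
  - unfold iterate. definability.
  - auto.
  - intros m U U' _ _ Hi _ HS. right. exists m, U. auto.
Qed.

Lemma iterate_functional :
  (forall n W W' W'', Step n W W' -> Step n W W'' -> W' = W'') ->
  forall n W W', iterate a Step n W -> iterate a Step n W' -> W = W'.
Proof.
  intros HF n W W' H. revert W'.
  apply (iterate_ind (fun n W => forall W', iterate a Step n W' -> W = W')) in H; [tauto | | |].
  - unfold iterate. definability.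
  - intros W' H'. apply iterate_inv in H' as [[_ ->] | (m & U & _ & E & _)]; [reflexivity|].
    symmetry in E. destruct (succ_not_empty m E).
  - intros m U U' Hm _ _ IH HS W' H'.
    apply iterate_inv in H' as [[E _] | (m' & U'' & Hi & E & HS')].
    + destruct (succ_not_empty m E).
    + apply succ_inj in E as <-; [|exact Hm].
      apply IH in Hi as <-. exact (HF _ _ _ _ HS HS').
Qed.

Lemma iterate_antitone :
  (forall n W W' W'', Step n W W' -> Step n W W'' -> W' = W'') ->
  (forall n W W', Step n W W' -> W' ⊆ W) ->
  forall n W, iterate a Step n W ->
  forall m W', m ∈ n \/ m = n -> iterate a Step m W' -> W ⊆ W'.
Proof.
  intros HF HS n W H.
  apply (iterate_ind (fun n W => forall m W', m ∈ n \/ m = n -> iterate a Step m W' -> W ⊆ W'))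
    in H; [tauto | | |].
  - unfold iterate. definability.
  - intros m W' [Hm | ->] H'; [destruct (in_empty m Hm)|].
    rewrite (iterate_functional HF _ _ _ iterate_zero H'). intros x; auto.
  - intros k U U' Hk _ Hi IH HU m W' Hm H'. destruct Hm as [Hm | ->].
    + intros x Hx. apply (IH m W'); [apply in_adjoin, Hm | exact H' | exact (HS k U U' HU x Hx)].
    + rewrite (iterate_functional HF _ _ _ (iterate_succ _ _ _ Hi HU) H'). intros x; auto.
Qed.

Lemma iterate_exists :
  (forall n W, iterate a Step n W -> exists W', Step n W W') ->
  forall n, n ∈ omega -> exists W, iterate a Step n W.
Proof.
  intros HE. apply (omega_ind (fun n => exists W, iterate a Step n W)).
  - unfold iterate. definability.
  - exists a. exact iterate_zero.
  - intros n _ [W H]. destruct (HE n W H) as [W' HW']. exists W'.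
    exact (iterate_succ n W W' H HW').
Qed.

End Recursion.

(** * Multiple choice from a countable union of finite sets *)

(** By foundation, a non-empty definable class of natural numbers has a minimal
    element. *)
Lemma omega_least (P : V -> Prop) n : class_definable P -> n ∈ omega -> P n ->
  exists m, m ∈ omega /\ P m /\ forall k, k ∈ omega -> P k -> ~ k ∈ m.
Proof.
  intros Hd Hn HP.
  destruct (zf_foundation HZF (x := sep omega P)) as (m & Hm & Hmin).
  - exists n. apply in_sep; auto.
  - apply in_sep in Hm as [Hm HPm]; [|exact Hd].
    exists m. split; [exact Hm|]. split; [exact HPm|].
    intros k Hk HPk. apply Hmin, in_sep; auto.
Qed.

(** A cuf set B has a function M, defined on its non-empty subsets, that selects
    from each of them a non-empty finite subset. *)
Lemma cuf_multiple_choice (B : V) : cuf B -> exists M : V,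
  (forall Phi Psi Psi', maps M Phi Psi -> maps M Phi Psi' -> Psi = Psi') /\
  (forall Phi Psi, maps M Phi Psi -> Psi ⊆ Phi /\ nonempty Psi /\ finite Psi) /\
  (forall Phi, Phi ⊆ B -> nonempty Phi -> exists Psi, maps M Phi Psi).
Proof.
  intros (F & (w & s & Hw & Hs & h & Hh) & Hfin & HB).
  apply is_omega_eq in Hw as ->.
  apply bijection_iff in Hh as (H1 & H2 & H3 & H4).
  assert (Hin : forall a n, maps h a n -> a ∈ F /\ n ∈ omega).
  { intros a n H. apply maps_eq in H. destruct (H1 _ H) as (a' & b' & Ha & Hb & E).
    apply opair_inj in E as [-> ->]. auto. }
  (* [least Phi n a]: the set a of F meets Phi and its index n is minimal for
     this; such an a is unique because ω is linearly ordered. *)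
  set (least := fun Phi n a => maps h a n /\ nonempty (inter Phi a) /\
    forall n' a', maps h a' n' -> nonempty (inter Phi a') -> ~ n' ∈ n).
  set (P := fun p => exists Phi n a, p = opair Phi (inter Phi a) /\ least Phi n a).
  assert (Hd : class_definable P) by (unfold P, least; definability).
  exists (sep (prod (power B) (power B)) P).
  assert (HM : forall Phi Psi, maps (sep (prod (power B) (power B)) P) Phi Psi <->
    Phi ⊆ B /\ Psi ⊆ B /\ exists n a, Psi = inter Phi a /\ least Phi n a).
  { intros Phi Psi. rewrite maps_eq, in_sep, in_prod, !in_power; [|exact Hd]. split.
    - intros [[HP HQ] (Phi' & n & a & E & H)]. apply opair_inj in E as [-> ->].
      split; [exact HP|]. split; [exact HQ|]. exists n, a. auto.
    - intros (HP & HQ & n & a & -> & H). split; [auto|]. exists Phi, n, a. auto. }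
  split; [|split].
  - intros Phi Psi Psi' H H'. apply HM in H as (_ & _ & n & a & -> & Ha & Hna & Hmin).
    apply HM in H' as (_ & _ & n' & a' & -> & Ha' & Hna' & Hmin').
    replace a' with a; [reflexivity|]. apply (H4 a a' n n' Ha Ha').
    destruct (omega_trichotomy n n') as [H | [H | H]];
      [apply (Hin a n Ha) | apply (Hin a' n' Ha') | | exact H |].
    + destruct (Hmin' n a Ha Hna H).
    + destruct (Hmin n' a' Ha' Hna' H).
  - intros Phi Psi H. apply HM in H as (_ & _ & n & a & -> & Ha & Hna & _).
    split; [intros U HU; apply in_inter in HU; tauto|]. split; [exact Hna|].
    apply (finite_subset a); [apply Hfin, (Hin a n Ha)|].
    intros U HU; apply in_inter in HU; tauto.
  - intros Phi HPhi [U HU].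
    destruct (proj1 (HB U) (HPhi U HU)) as (a0 & Ha0 & HUa).
    destruct (H2 a0 Ha0) as [n0 Hn0].
    destruct (omega_least (fun n => exists a, maps h a n /\ nonempty (inter Phi a)) n0)
      as (n & Hn & (a & Ha & Hna) & Hmin).
    + definability.
    + apply (Hin a0 n0 Hn0).
    + exists a0. split; [exact Hn0|]. exists U. apply in_inter. auto.
    + exists (inter Phi a). apply HM. split; [exact HPhi|]. split.
      * intros W HW. apply in_inter in HW as [HW _]. auto.
      * exists n, a. split; [reflexivity|]. split; [exact Ha|]. split; [exact Hna|].
        intros n' a' Ha' Hna'. apply Hmin; [apply (Hin a' n' Ha') | exists a'; auto].
Qed.

(** * Compact cores of relatively closed subsets of a G-delta set *)

Section Core.
Context (X T : V) (Htop : topology X T) (Hhaus : hausdorff X T) (Hlc : locally_compact X T).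
(* M is a multiple choice function for the base B, and g enumerates the family G
   of open sets, whose intersection is Y, by a set s of natural numbers. *)
Context (B M : V) (HB : base T B)
  (Mfun : forall Phi Psi Psi', maps M Phi Psi -> maps M Phi Psi' -> Psi = Psi')
  (Msub : forall Phi Psi, maps M Phi Psi -> Psi ⊆ Phi /\ nonempty Psi /\ finite Psi)
  (Mtot : forall Phi, Phi ⊆ B -> nonempty Phi -> exists Psi, maps M Phi Psi).
Context (Y G g s : V) (HGT : G ⊆ T)
  (HY : forall x, x ∈ Y <-> x ∈ X /\ forall U, U ∈ G -> x ∈ U)
  (Hs : s ⊆ omega) (Hg : bijection g G s).

(** The members of the base B that meet C and have a compact hull inside W and
    inside the n-th set of G, if there is one; a number that is not an index
    imposes no condition. *)
Definition shrinking_family (C n W : V) : V :=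
  sep B (fun U => (exists z, z ∈ U /\ z ∈ C) /\
    exists K, compact X T K /\ U ⊆ K /\ K ⊆ W /\ forall O, maps g O n -> K ⊆ O).

(** W' is the union of the finite family selected from the shrinking family. *)
Definition shrink (C n W W' : V) : Prop :=
  exists Psi, maps M (shrinking_family C n W) Psi /\ W' = union Psi.

(** The points all of whose open neighbourhoods meet every W ∩ C, where W is a term
    of the sequence obtained from X by shrinking. *)
Definition core (C : V) : V :=
  sep X (fun x => forall O, O ∈ T -> x ∈ O ->
    forall n W, iterate X (shrink C) n W -> exists z, z ∈ O /\ z ∈ W /\ z ∈ C).

Lemma in_shrinking_family C n W U : U ∈ shrinking_family C n W <->
  U ∈ B /\ (exists z, z ∈ U /\ z ∈ C) /\
  exists K, compact X T K /\ U ⊆ K /\ K ⊆ W /\ forall O, maps g O n -> K ⊆ O.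
Proof. refine (in_sep B _ U _). definability. Qed.

Lemma shrink_definable C : relation3_definable (shrink C).
Proof. unfold shrink, shrinking_family. definability. Qed.

Lemma in_core C x : x ∈ core C <-> x ∈ X /\ forall O, O ∈ T -> x ∈ O ->
    forall n W, iterate X (shrink C) n W -> exists z, z ∈ O /\ z ∈ W /\ z ∈ C.
Proof.
  refine (in_sep X _ x _). unfold iterate, shrink, shrinking_family. definability.
Qed.

(** The core depends definably on C, which allows the cores of all C to be used in
    one instance of separation. *)
Lemma definable_core t : definable_fun t -> definable_fun (fun e => core (t e)).
Proof.
  intro Ht.
  apply (definable_fun_spec (fun x e => x = core (t e))); [tauto|].
  apply (definable_app (fun y e => e 0 = core y)); [apply definable_fun_shift, Ht|].
  unfold core, iterate, shrink, shrinking_family. definability.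
Qed.

Lemma shrink_functional C n W W' W'' : shrink C n W W' -> shrink C n W W'' -> W' = W''.
Proof.
  intros (Psi & HP & ->) (Psi' & HP' & ->). f_equal. exact (Mfun _ _ _ HP HP').
Qed.

Lemma shrink_open C n W W' : shrink C n W W' -> W' ∈ T.
Proof.
  intros (Psi & HP & ->). apply (open_union X T Htop). intros U HU.
  apply (proj1 (Msub _ _ HP)) in HU. apply in_shrinking_family in HU as [HU _].
  apply HB, HU.
Qed.

Lemma shrink_hull C n W W' : shrink C n W W' ->
  exists K, compact X T K /\ W' ⊆ K /\ K ⊆ W /\ forall O, maps g O n -> K ⊆ O.
Proof.
  intros (Psi & HP & ->). destruct (Msub _ _ HP) as (Hsub & _ & Hfin).
  assert (Hd : class_definable (fun x => forall O, maps g O n -> x ∈ O)) by definability.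
  destruct (finite_compact_hull X T Psi (sep W (fun x => forall O, maps g O n -> x ∈ O)) Hfin)
    as (K & HK & HPK & HKO).
  - intros U HU. apply Hsub, in_shrinking_family in HU as (_ & _ & K & HK & HUK & HKW & HKO).
    exists K. split; [exact HK|]. split; [exact HUK|].
    intros x Hx. apply in_sep; [exact Hd|]. split; [auto|]. intros O HO. exact (HKO O HO x Hx).
  - exists K. split; [exact HK|]. split; [exact HPK|]. split.
    + intros x Hx. apply HKO, in_sep in Hx; [tauto | exact Hd].
    + intros O HO x Hx. apply HKO, in_sep in Hx as [_ Hx]; [auto | exact Hd].
Qed.

Lemma shrink_decreasing C n W W' : shrink C n W W' -> W' ⊆ W.
Proof.
  intros H. destruct (shrink_hull _ _ _ _ H) as (K & _ & H1 & H2 & _).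
  intros x Hx. auto.
Qed.

Lemma shrink_meets C n W W' : shrink C n W W' -> exists z, z ∈ W' /\ z ∈ C.
Proof.
  intros (Psi & HP & ->). destruct (Msub _ _ HP) as (Hsub & [U HU] & _).
  pose proof (Hsub U HU) as HU'.
  apply in_shrinking_family in HU' as (_ & (z & HzU & HzC) & _).
  exists z. split; [apply in_union; eauto | exact HzC].
Qed.

Section OneSet.
Context (C : V) (HCY : C ⊆ Y) (HC : nonempty C).

Lemma shrink_exists n W : W ∈ T -> (exists z, z ∈ W /\ z ∈ C) -> exists W', shrink C n W W'.
Proof.
  intros HW (c & HcW & HcC).
  (* O is W intersected with the n-th set of G, or W itself when n is no index. *)
  assert (HO : exists O, O ∈ T /\ c ∈ O /\ O ⊆ W /\ forall U, maps g U n -> O ⊆ U).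
  { apply bijection_iff in Hg as (H1 & _ & _ & H4).
    destruct (classic (exists U, maps g U n)) as [[U HU] | HU].
    - assert (HUG : U ∈ G).
      { rewrite maps_eq in HU. destruct (H1 _ HU) as (U' & n' & HUG & _ & E).
        apply opair_inj in E as [-> _]. exact HUG. }
      exists (inter W U). split; [apply (open_inter X T Htop); auto|]. split.
      + apply in_inter. split; [exact HcW|]. apply HCY, HY in HcC. apply HcC, HUG.
      + split; [intros x Hx; apply in_inter in Hx; tauto|].
        intros U' HU'. rewrite (proj2 (H4 U' U n n HU' HU) eq_refl).
        intros x Hx; apply in_inter in Hx; tauto.
    - exists W. split; [exact HW|]. split; [exact HcW|]. split; [intros x; auto|].
      intros U HU'. destruct HU. eauto. }
  destruct HO as (O & HOT & HcO & HOW & HOU).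
  destruct (base_compact_inside X T Htop Hhaus Hlc B O c HB HOT HcO)
    as (U & K & HU & HcU & HUK & HK & HKO).
  destruct (Mtot (shrinking_family C n W)) as [Psi HPsi].
  - intros U' HU'. apply in_shrinking_family in HU'; tauto.
  - exists U. apply in_shrinking_family. split; [exact HU|]. split; [eauto|].
    exists K. split; [exact HK|]. split; [exact HUK|]. split; [intros x Hx; auto|].
    intros U' HU' x Hx. apply (HOU U' HU'); auto.
  - exists (union Psi), Psi. auto.
Qed.

Local Notation stage := (iterate X (shrink C)).

Lemma stage_spec n W : stage n W -> n ∈ omega /\ W ∈ T /\ exists z, z ∈ W /\ z ∈ C.
Proof.
  apply (iterate_ind T X (shrink C) (shrink_definable C) (open_whole X T Htop) (fun n W W' _ => shrink_open C n W W')
    (fun n W => exists z, z ∈ W /\ z ∈ C)).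
  - definability.
  - destruct HC as [c Hc]. exists c. split; [|exact Hc]. apply HCY, HY in Hc. tauto.
  - intros m W1 W2 _ _ _ _. apply shrink_meets.
Qed.

Lemma stage_step n W : stage n W -> exists W', shrink C n W W'.
Proof. intro H. apply stage_spec in H as (_ & HW & Hz). exact (shrink_exists n W HW Hz). Qed.

Lemma stage_exists n : n ∈ omega -> exists W, stage n W.
Proof.
  apply (iterate_exists X (shrink C) (shrink_definable C)). exact stage_step.
Qed.

Lemma stage_comparable n m W W' : stage n W -> stage m W' -> W ⊆ W' \/ W' ⊆ W.
Proof.
  intros H H'.
  assert (Hle : forall n W, stage n W -> forall m W', m ∈ n \/ m = n -> stage m W' -> W ⊆ W').
  { apply (iterate_antitone T X (shrink C) (shrink_definable C) (open_whole X T Htop)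
      (fun n W W' _ => shrink_open C n W W') (shrink_functional C) (shrink_decreasing C)). }
  destruct (omega_trichotomy n m) as [Hnm | [Hnm | Hnm]];
    [apply (stage_spec n W H) | apply (stage_spec m W' H') | | |].
  - right. exact (Hle m W' H' n W (or_introl Hnm) H).
  - left. exact (Hle n W H m W' (or_intror (eq_sym Hnm)) H').
  - left. exact (Hle n W H m W' (or_introl Hnm) H').
Qed.

Lemma core_in_hull n W K : stage n W -> compact X T K -> W ⊆ K -> core C ⊆ K.
Proof.
  intros HW HK HWK x Hx. apply in_core in Hx as [HxX Hx].
  apply NNPP. intro HxK.
  destruct (Hx (diff X K) (compact_closed X T Htop Hhaus K HK)) with n W as (z & HzK & HzW & _).
  - apply in_diff. auto.
  - exact HW.
  - apply in_diff in HzK as [_ HzK]. auto.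
Qed.

Lemma core_closed : diff X (core C) ∈ T.
Proof.
  apply (open_local X T Htop). intros x Hx. apply in_diff in Hx as [HxX Hx].
  apply NNPP. intro Hno. apply Hx, in_core. split; [exact HxX|].
  intros O HO HxO n W HW. apply NNPP. intro Hz. apply Hno.
  exists O. split; [exact HO|]. split; [exact HxO|].
  intros y HyO. apply in_diff. split; [exact (open_subset X T Htop O HO y HyO)|].
  intro Hy. apply in_core in Hy as [_ Hy]. apply Hz, (Hy O HO HyO n W HW).
Qed.

Lemma core_compact : compact X T (core C).
Proof.
  destruct (stage_step empty X (iterate_zero X (shrink C))) as [W1 H1].
  destruct (shrink_hull _ _ _ _ H1) as (K & HK & HWK & _ & _).
  pose proof (iterate_succ _ _ _ _ _ (iterate_zero X (shrink C)) H1) as HW1.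
  (* The core is a closed subset of the compact hull of the first shrunken set. *)
  replace (core C) with (diff K (diff X (core C))).
  - apply (compact_diff X T); [exact HK | exact core_closed].
  - apply set_ext. intro x. rewrite !in_diff. split.
    + intros [Hx Hn]. apply NNPP. intro Hc. apply Hn. split; [apply HK, Hx | exact Hc].
    + intro Hx. split; [exact (core_in_hull _ _ K HW1 HK HWK x Hx) | tauto].
Qed.

Lemma core_nonempty : nonempty (core C).
Proof.
  apply NNPP. intro Hempty.
  destruct (stage_step empty X (iterate_zero X (shrink C))) as [W1 H1].
  destruct (shrink_hull _ _ _ _ H1) as (K & HK & HWK & _ & _).
  pose proof (iterate_succ _ _ _ _ _ (iterate_zero X (shrink C)) H1) as HW1.
  set (P := fun O => exists n W, stage n W /\ forall z, ~ (z ∈ O /\ z ∈ W /\ z ∈ C)).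
  pose proof (shrink_definable C) as Hsd.
  assert (Hd : class_definable P) by (unfold P, iterate; definability).
  destruct (proj2 HK (sep T P)) as (F & HF & Hfin & HFK).
  - intros O HO. apply in_sep in HO; tauto.
  - intros x Hx. apply NNPP. intro Hno. apply Hempty. exists x. apply in_core.
    split; [apply HK, Hx|]. intros O HO HxO n W HW. apply NNPP. intro Hz.
    apply Hno. exists O. split; [|exact HxO]. apply in_sep; [exact Hd|].
    split; [exact HO|]. exists n, W. split; [exact HW|]. intros z Hz'. apply Hz. exists z. exact Hz'.
  - assert (HP : forall O, O ∈ F -> P O) by (intros O HO; apply HF, in_sep in HO; tauto).
    (* Starting from W1 keeps the final term inside the compact set K that F
       covers. *)
    assert (Hlast : exists n W, stage n W /\ W ⊆ W1 /\
      forall O, O ∈ F -> forall z, ~ (z ∈ O /\ z ∈ W /\ z ∈ C)).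
    { clear HF HFK. revert F Hfin HP.
      apply (finite_ind (fun F => (forall O, O ∈ F -> P O) -> exists n W, stage n W /\ W ⊆ W1 /\
        forall O, O ∈ F -> forall z, ~ (z ∈ O /\ z ∈ W /\ z ∈ C)));
        [unfold iterate; definability | |].
      - intros _. exists (succ empty), W1. split; [exact HW1|]. split; [intros z; auto|].
        intros O HO. destruct (in_empty O HO).
      - intros F O IH H.
        destruct IH as (n & W & HW & HWW & HFW); [intros O' HO'; apply H, in_adjoin; auto|].
        destruct (H O) as (m & W' & HW' & HOW); [apply in_adjoin; auto|].
        destruct (stage_comparable n m W W' HW HW') as [Hle | Hle].
        + exists n, W. split; [exact HW|]. split; [exact HWW|].
          intros O' HO' z (Hz1 & Hz2 & Hz3).
          apply in_adjoin in HO' as [HO' | ->]; [apply (HFW O' HO' z) | apply (HOW z)]; auto.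
        + exists m, W'. split; [exact HW'|]. split; [intros z Hz; auto|].
          intros O' HO' z (Hz1 & Hz2 & Hz3).
          apply in_adjoin in HO' as [HO' | ->]; [apply (HFW O' HO' z) | apply (HOW z)]; auto. }
    destruct Hlast as (n & W & HW & HWW & Hlast).
    destruct (stage_spec n W HW) as (_ & _ & z & HzW & HzC).
    destruct (HFK z) as (O & HO & HzO); [auto|].
    exact (Hlast O HO z (conj HzO (conj HzW HzC))).
Qed.

Lemma core_subset_G_delta : core C ⊆ Y.
Proof.
  intros x Hx. apply HY. split; [apply in_core in Hx; tauto|].
  intros U HU. pose proof Hg as Hg'. apply bijection_iff in Hg' as (H1 & H2 & _ & _).
  destruct (H2 U HU) as [n Hn].
  assert (Hno : n ∈ omega).
  { pose proof Hn as Hn'. rewrite maps_eq in Hn'. destruct (H1 _ Hn') as (U' & n' & _ & Hn0 & E).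
    apply opair_inj in E as [_ ->]. apply Hs, Hn0. }
  destruct (stage_exists n Hno) as [W HW]. destruct (stage_step n W HW) as [W' HW'].
  destruct (shrink_hull _ _ _ _ HW') as (K & HK & HWK & _ & HKU).
  apply (HKU U Hn).
  exact (core_in_hull _ _ K (iterate_succ _ _ _ _ _ HW HW') HK HWK x Hx).
Qed.

Lemma core_subset S : subspace_topology T Y S -> closed Y S C -> core C ⊆ C.
Proof.
  intros HS (_ & O & HO & HOC) x Hx. pose proof (core_subset_G_delta x Hx) as HxY.
  apply NNPP. intro HxC.
  (* A point of Y outside C has a neighbourhood U with U ∩ C empty, whereas the
     neighbourhoods of a point of the core meet C. *)
  apply HS in HO as (U & HU & HOU).
  assert (HxO : x ∈ O) by (apply HOC; auto).
  apply HOU in HxO as [HxU _]. apply in_core in Hx as [_ Hx].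
  destruct (Hx U HU HxU empty X (iterate_zero X (shrink C))) as (z & HzU & _ & HzC).
  assert (HzO : z ∈ O) by (apply HOU; auto).
  apply HOC in HzO. tauto.
Qed.

End OneSet.

End Core.

(** To choose points of closed sets it suffices to find in them, definably,
    non-empty compact subsets of a K-Loeb space. *)
Lemma Loeb_of_core (X T Y S : V) (sub : V -> V) :
  K_Loeb X T ->
  (forall t, definable_fun t -> definable_fun (fun e => sub (t e))) ->
  (forall C, closed Y S C -> nonempty C ->
     compact X T (sub C) /\ nonempty (sub C) /\ sub C ⊆ C) ->
  Loeb Y S.
Proof.
  intros (KK & HKK & k & [[Hk1 Hk2] Hk3]) Hsub H.
  assert (HdF : class_definable (fun C => closed Y S C /\ nonempty C)) by definability.
  set (F := sep (power Y) (fun C => closed Y S C /\ nonempty C)).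
  assert (HF : forall C, C ∈ F <-> closed Y S C /\ nonempty C).
  { intro C. unfold F. rewrite in_sep, in_power; [|exact HdF]. unfold closed. tauto. }
  exists F. split; [exact HF|].
  set (P := fun p => exists C y, p = opair C y /\ maps k (sub C) y).
  assert (Hd : class_definable P).
  { unfold P. definability. apply (Hsub (fun e => e 1)), definable_var. }
  exists (sep (prod F Y) P).
  assert (Hm : forall C y, maps (sep (prod F Y) P) C y <-> C ∈ F /\ y ∈ Y /\ maps k (sub C) y).
  { intros C y. rewrite maps_eq, in_sep, in_prod; [|exact Hd]. split.
    - intros [[HC Hy] (C' & y' & E & Hky)]. apply opair_inj in E as [-> ->]. auto.
    - intros (HC & Hy & Hky). split; [auto|]. exists C, y. auto. }
  split; [split|].
  - intros p Hp. apply in_sep in Hp as [Hp (C & y & -> & _)]; [|exact Hd].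
    apply in_prod in Hp as [HC _]. exists C, y. rewrite is_opair_eq. auto.
  - intros C HC. pose proof (proj1 (HF C) HC) as [Hcl Hne].
    destruct (H C Hcl Hne) as (Hc & Hn & Hs).
    destruct (Hk2 (sub C)) as (y & Hy & Huniq); [apply HKK; auto|].
    exists y. split.
    + apply Hm. split; [exact HC|]. split; [|exact Hy].
      apply (proj1 Hcl), Hs, (Hk3 _ _ Hy).
    + intros y' Hy'. apply Hm in Hy' as (_ & _ & Hy'). auto.
  - intros C y Hy. apply Hm in Hy as (HC & _ & Hy).
    apply HF in HC as [Hcl Hne]. destruct (H C Hcl Hne) as (_ & _ & Hs).
    apply Hs, (Hk3 _ _ Hy).
Qed.

End InModel.

Theorem theorem2p6 (V : set_structure) (HZF : ZF V) (X T : V)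
  (Htop : topology X T)
  (Hlc : locally_compact X T)
  (Hhaus : hausdorff X T)
  (HKL : K_Loeb X T)
  (Hcuf : has_cuf_base T) :
  forall Y S : V, G_delta X T Y -> subspace_topology T Y S -> Loeb Y S.
Proof.
  intros Y S (G & (w & s & Hw & Hs & g & Hg) & HGT & HY) HS.
  apply (is_omega_eq HZF) in Hw as ->.
  destruct Hcuf as (B & HB & HBcuf).
  destruct (cuf_multiple_choice HZF B HBcuf) as (M & Mfun & Msub & Mtot).
  apply (Loeb_of_core HZF X T Y S (core HZF X T B M g)); [exact HKL | |].
  - apply definable_core.
  - intros C HC HCn. pose proof (proj1 HC) as HCY. split; [|split].
    + eapply core_compact; eassumption.
    + eapply core_nonempty; eassumption.
    + eapply core_subset; eassumption.
Qed.
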